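(* Let $R$ be a simple ring with unity which is a $\mathbb{C}$-algebra. Let $G$ be a group of outer automorphisms of $R$. Let $X$ be a finite set on which $G$ acts. If $G$ acts transitively on $X$, then the ring $(R\otimes_{\mathbb{C}}\mathbb{C}^{X})\rtimes G$ is simple.
   Context: An automorphism of $R$ is outer if it is not inner (i.e. not of the form $r\mapsto uru^{-1}$ with $u\in R^\times$). A group $G$ acting on $R$ by ($\mathbb{C}$-algebra) automorphisms is called a group of outer automorphisms of $R$ if each non-identity element of $G$ induces an outer automorphism of $R$. $\mathbb{C}^X$ is the algebra of functions $X\to\mathbb{C}$ with pointwise operations, with basis the orthogonal idempotents $\epsilon_\lambda$ ($\lambda\in X$); $G$ acts on it by $g\cdot\epsilon_\lambda=\epsilon_{g(\lambda)}$. $G$ acts diagonally on $R\otimes_{\mathbb{C}}\mathbb{C}^X$, and $(R\otimes\mathbb{C}^X)\rtimes G$ is the corresponding skew group ring: the free left $R\otimes\mathbb{C}^X$-module on $G$ with multiplication $(ag)(bh)=a\,g(b)\,gh$. A ring is simple if it is nonzero and its only two-sided ideals are $0$ and itself. *)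

(* Defs.v *)
From HB Require Import structures.
From mathcomp Require Import all_boot all_order all_algebra.
From mathcomp Require Import finmap boolp reals complex monalg.

Set Implicit Arguments.
Unset Strict Implicit.
Unset Printing Implicit Defensive.

Import GRing.Theory.
Local Open Scope ring_scope.
Local Open Scope quotient_scope.

(* Ideals are Prop-valued predicates, so that "every ideal" is not restricted
   to decidable ones. *)
Definition two_sided_ideal (S : pzRingType) (I : S -> Prop) : Prop :=
  [/\ I 0,
      forall x y, I x -> I y -> I (x + y) &
      forall a x, I x -> I (a * x) /\ I (x * a)].

Definition simple_ring (S : pzRingType) : Prop :=
  (1 : S) <> 0 /\
  forall I : S -> Prop, two_sided_ideal I ->
    (forall x, I x <-> x = 0) \/ (forall x, I x).

Record set_action (G : groupType) (X : Type) := SetAction {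
  sact :> G -> X -> X;
  sact1 : forall x, sact 1%g x = x;
  sactM : forall g h x, sact (g * h)%g x = sact g (sact h x) }.

Record ring_action (G : groupType) (A : pzRingType) := RingAction {
  ract :> G -> {rmorphism A -> A};
  ract1 : forall a, ract 1%g a = a;
  ractM : forall g h a, ract (g * h)%g a = ract g (ract h a) }.

Record alg_action (G : groupType) (K : pzRingType) (A : algType K) :=
  AlgAction {
    aact :> G -> {lrmorphism A -> A};
    aact1 : forall a, aact 1%g a = a;
    aactM : forall g h a, aact (g * h)%g a = aact g (aact h a) }.

(* The orbit is all of X and X is not empty: an action on the empty set has no
   orbit, hence is not transitive. *)
Definition transitive_action (G : groupType) (X : Type)
    (to : set_action G X) : Prop :=
  exists x, forall y, exists g, to g x = y.

(* The ring A need not be a unitRingType, so units are given with their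
   inverse. *)
Definition inner_automorphism (A : pzRingType) (f : A -> A) : Prop :=
  exists u v : A, [/\ u * v = 1, v * u = 1 & forall r, f r = u * r * v].

Definition outer_action (G : groupType) (K : pzRingType) (A : algType K)
    (to : alg_action G A) : Prop :=
  forall g : G, g <> 1%g -> ~ inner_automorphism (to g).

Fact linear_fun0 (K : pzRingType) (V U : lmodType K) (f : V -> U) :
  linear f -> f 0 = 0.
Proof.
by move=> /(_ (-1) 0 0); rewrite scaler0 addr0 scaleN1r addNr.
Qed.

(* The tensor product V ⊗ W of K-modules: the free K-module on V * W modulo
   the submodule generated by the bilinearity relations *)

Section TensorModule.
Context (K : comNzRingType) (V W : lmodType K).
Local Notation free := {malg K[(V * W)%type]}.

Inductive tensor_rel : free -> Prop :=
| tensor_rel0 : tensor_rel 0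
| tensor_relD x y : tensor_rel x -> tensor_rel y -> tensor_rel (x + y)
| tensor_relZ (a : K) x : tensor_rel x -> tensor_rel (a *: x)
| tensor_rel_addl v1 v2 w :
    tensor_rel (<< (v1 + v2, w) >> - << (v1, w) >> - << (v2, w) >>)
| tensor_rel_addr v w1 w2 :
    tensor_rel (<< (v, w1 + w2) >> - << (v, w1) >> - << (v, w2) >>)
| tensor_rel_scalel (a : K) v w :
    tensor_rel (<< (a *: v, w) >> - a *: << (v, w) >>)
| tensor_rel_scaler (a : K) v w :
    tensor_rel (<< (v, a *: w) >> - a *: << (v, w) >>).

Definition tensor_relb : {pred free} := fun x => `[< tensor_rel x >].

Fact tensor_relb_closed : zmod_closed tensor_relb.
Proof.
split=> [|x y]; first exact/asboolP/tensor_rel0.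
move=> /asboolP xR /asboolP yR; apply/asboolP.
by apply: tensor_relD => //; rewrite -scaleN1r; apply: tensor_relZ.
Qed.
HB.instance Definition _ := GRing.isZmodClosed.Build free tensor_relb
  tensor_relb_closed.

Definition tensor : Type := Quotient.quot tensor_relb.
HB.instance Definition _ := GRing.Zmodule.on tensor.

Definition tensor_pi (x : free) : tensor := \pi_(Quotient.quot tensor_relb) x.
Definition tensor_repr (t : tensor) : free :=
  repr (t : Quotient.quot tensor_relb).

Lemma tensor_reprK : cancel tensor_repr tensor_pi.
Proof. exact: reprK. Qed.

Lemma tensor_piP x y : tensor_pi x = tensor_pi y <-> tensor_rel (x - y).
Proof.
split=> [/eqP|xy]; last apply/eqP.
  by rewrite -Quotient.idealrBE => /asboolP.
by rewrite -Quotient.idealrBE; apply/asboolP.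
Qed.

Fact tensor_pi_is_zmod_morphism : zmod_morphism tensor_pi.
Proof. exact: (raddfB \pi_(Quotient.quot tensor_relb)). Qed.
HB.instance Definition _ := GRing.isZmodMorphism.Build free tensor tensor_pi
  tensor_pi_is_zmod_morphism.

Definition tensor_scale (a : K) (t : tensor) : tensor :=
  tensor_pi (a *: tensor_repr t).

Lemma tensor_scale_pi a x : tensor_scale a (tensor_pi x) = tensor_pi (a *: x).
Proof.
apply/tensor_piP; rewrite -scalerBr; apply: tensor_relZ.
by apply/tensor_piP; rewrite tensor_reprK.
Qed.

Fact tensor_scalerA a b t :
  tensor_scale a (tensor_scale b t) = tensor_scale (a * b) t.
Proof. by rewrite -[t]tensor_reprK !tensor_scale_pi scalerA. Qed.
Fact tensor_scale1r : left_id 1 tensor_scale.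
Proof. by move=> t; rewrite -[t]tensor_reprK tensor_scale_pi scale1r. Qed.
Fact tensor_scalerDr : right_distributive tensor_scale +%R.
Proof.
move=> a s t; rewrite -[s]tensor_reprK -[t]tensor_reprK -raddfD.
by rewrite !tensor_scale_pi scalerDr raddfD.
Qed.
Fact tensor_scalerDl t : {morph tensor_scale^~ t : a b / a + b}.
Proof.
by move=> a b; rewrite -[t]tensor_reprK !tensor_scale_pi scalerDl raddfD.
Qed.
HB.instance Definition _ := GRing.Zmodule_isLmodule.Build K tensor
  tensor_scalerA tensor_scale1r tensor_scalerDr tensor_scalerDl.

Definition ptensor (v : V) (w : W) : tensor := tensor_pi << (v, w) >>.

Definition bilinear_map (U : lmodType K) (f : V -> W -> U) : Prop :=
  (forall v, linear (f v)) /\ (forall w, linear (f^~ w)).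

Lemma ptensor_bilinear : bilinear_map ptensor.
Proof.
have piZ a x : a *: tensor_pi x = tensor_pi (a *: x).
  exact: tensor_scale_pi.
split=> [v a w1 w2|w a v1 v2]; rewrite /ptensor piZ.
  transitivity (tensor_pi (<< (v, a *: w1) >> + << (v, w2) >>)).
    by apply/tensor_piP; rewrite opprD addrA; apply: tensor_rel_addr.
  by rewrite !raddfD /=; congr (_ + _); apply/tensor_piP/tensor_rel_scaler.
transitivity (tensor_pi (<< (a *: v1, w) >> + << (v2, w) >>)).
  by apply/tensor_piP; rewrite opprD addrA; apply: tensor_rel_addl.
by rewrite !raddfD /=; congr (_ + _); apply/tensor_piP/tensor_rel_scalel.
Qed.

Lemma tensor_ind (P : tensor -> Prop) :
  P 0 -> (forall a v w t, P t -> P (a *: ptensor v w + t)) -> forall t, P t.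
Proof.
move=> P0 PD t; rewrite -[t]tensor_reprK [tensor_repr t]monalgE raddf_sum /=.
elim: (X in \sum_(_ <- X) _) => [|[v w] s IHs]; rewrite ?big_nil ?big_cons //.
set c := _@__; suff -> : tensor_pi << c *g (v, w) >> = c *: ptensor v w.
  exact: PD.
rewrite [RHS]tensor_scale_pi; congr tensor_pi; apply/malgP => k.
by rewrite mcoeffZ !mcoeffU mulrnAr mulr1.
Qed.

Section Lift.
Context (U : lmodType K).
Implicit Types f : V -> W -> U.

Definition free_lift f (x : free) : U :=
  \sum_(p <- msupp x) x@_p *: f p.1 p.2.

Lemma free_liftEw f (d : {fset V * W}) x : (msupp x `<=` d)%fset ->
  free_lift f x = \sum_(p <- d) x@_p *: f p.1 p.2.
Proof.
move=> le; rewrite [LHS](big_fset_incl _ le) => //= p pd /mcoeff_outdom ->.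
by rewrite scale0r.
Qed.

Fact free_lift_is_linear f : linear (free_lift f).
Proof.
move=> a x y; pose d := (msupp (a *: x + y) `|` msupp x `|` msupp y)%fset.
rewrite !(@free_liftEw f d) ?scaler_sumr -?big_split /=.
- by apply: eq_bigr => p _; rewrite mcoeffD mcoeffZ scalerDl scalerA.
- exact: fsubsetUr.
- by rewrite fsubsetU // fsubsetUr.
- by rewrite fsubsetU // fsubsetUl.
Qed.
HB.instance Definition _ f := GRing.isLinear.Build K free U _ (free_lift f)
  (free_lift_is_linear f).

Lemma free_liftU f v w : free_lift f << (v, w) >> = f v w.
Proof.
by rewrite (free_liftEw _ msuppU_le) big_seq_fset1 mcoeffUU scale1r.
Qed.

Lemma free_lift_rel f x : bilinear_map f -> tensor_rel x -> free_lift f x = 0.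
Proof.
move=> [fr fl]; elim=> [|y z _ y0 _ z0|a y _ y0|v1 v2 w|v w1 w2|a v w|a v w].
- exact: raddf0.
- by rewrite raddfD /= y0 z0 addr0.
- by rewrite linearZ /= y0 scaler0.
- rewrite !raddfB /= !free_liftU -[v1 in f (v1 + _)]scale1r fl scale1r.
  by rewrite [f _ _ + _]addrC addrK subrr.
- rewrite !raddfB /= !free_liftU -[w1 in f _ (w1 + _)]scale1r fr scale1r.
  by rewrite [f _ _ + _]addrC addrK subrr.
- rewrite linearB linearZ /= !free_liftU -[a *: v]addr0 fl.
  by rewrite (linear_fun0 (fl w)) addr0 subrr.
- rewrite linearB linearZ /= !free_liftU -[a *: w]addr0 fr.
  by rewrite (linear_fun0 (fr v)) addr0 subrr.
Qed.

(* Meaningful only for bilinear f; see tensor_lift_linear and tensor_liftE. *)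
Definition tensor_lift f (t : tensor) : U := free_lift f (tensor_repr t).

Lemma tensor_lift_pi f x :
  bilinear_map f -> tensor_lift f (tensor_pi x) = free_lift f x.
Proof.
move=> bf; apply/eqP; rewrite -subr_eq0 -raddfB; apply/eqP.
by apply: (free_lift_rel bf); apply/tensor_piP; rewrite tensor_reprK.
Qed.

Lemma tensor_lift_linear f : bilinear_map f -> linear (tensor_lift f).
Proof.
move=> bf a s t; rewrite -[s]tensor_reprK -[t]tensor_reprK.
rewrite [a *: _]tensor_scale_pi -raddfD.
by rewrite !(tensor_lift_pi _ bf) linearP.
Qed.

Lemma tensor_liftE f v w : bilinear_map f -> tensor_lift f (ptensor v w) = f v w.
Proof. by move=> bf; rewrite tensor_lift_pi // free_liftU. Qed.

Lemma tensor_lift_comb f1 f2 f (a : K) t :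
  (forall v w, f v w = a *: f1 v w + f2 v w) ->
  tensor_lift f t = a *: tensor_lift f1 t + tensor_lift f2 t.
Proof.
move=> fE; rewrite /tensor_lift /free_lift scaler_sumr -big_split /=.
by apply: eq_bigr => p _; rewrite fE scalerDr !scalerA mulrC.
Qed.

Lemma linear_tensor_ext (f1 f2 : tensor -> U) :
  linear f1 -> linear f2 ->
  (forall v w, f1 (ptensor v w) = f2 (ptensor v w)) -> f1 =1 f2.
Proof.
move=> l1 l2 e; elim/tensor_ind => [|a v w t IH]; first by rewrite !linear_fun0.
by rewrite l1 l2 e IH.
Qed.

End Lift.
End TensorModule.

Arguments ptensor {K V W} v w.
Notation "v ⊗ w" := (ptensor v w) (at level 40, left associativity).

(* The K-algebra A ⊗ K^X; K^X is {ffun X -> K^o}, with pointwise operations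
   (K^o is K viewed as a module over itself) *)

Section TensorFunAlgebra.
Context (K : comNzRingType) (A : algType K) (X : finType).
Local Notation B := {ffun X -> K^o}.

Definition tensor_fun : Type := tensor A B.
HB.instance Definition _ := GRing.Lmodule.on tensor_fun.
Implicit Types s t : tensor_fun.

(* The product determined by (a ⊗ f) * (b ⊗ h) = (a * b) ⊗ (f * h) *)
Definition tensor_mul s t : tensor_fun :=
  tensor_lift (fun (a : A) (f : B) =>
    tensor_lift (fun (b : A) (h : B) => (a * b) ⊗ (f * h)) t) s.

Definition tensor_one : tensor_fun := (1 : A) ⊗ (1 : B).

Lemma ffun_scalerAl (a : K) (f h : B) : a *: f * h = a *: (f * h).
Proof. by apply/ffunP => x; rewrite !ffunE -scalerAl. Qed.
Lemma ffun_scalerAr (a : K) (f h : B) : f * (a *: h) = a *: (f * h).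
Proof. by apply/ffunP => x; rewrite !ffunE -scalerAr. Qed.

Let bilr (a : A) (f : B) :
  bilinear_map (fun (b : A) (h : B) => (a * b) ⊗ (f * h)).
Proof.
split=> [b c h1 h2|h c b1 b2].
  by rewrite mulrDr ffun_scalerAr (ptensor_bilinear _ _).1.
by rewrite mulrDr -scalerAr (ptensor_bilinear _ _).2.
Qed.

Let bill t :
  bilinear_map (fun (a : A) (f : B) =>
    tensor_lift (fun (b : A) (h : B) => (a * b) ⊗ (f * h)) t).
Proof.
split=> [a c f1 f2|f c a1 a2]; apply: tensor_lift_comb => b h.
  by rewrite mulrDl ffun_scalerAl (ptensor_bilinear _ _).1.
by rewrite mulrDl -scalerAl (ptensor_bilinear _ _).2.
Qed.

Lemma tensor_mulE (a b : A) (f h : B) :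
  tensor_mul (a ⊗ f) (b ⊗ h) = (a * b) ⊗ (f * h).
Proof. by rewrite /tensor_mul tensor_liftE // tensor_liftE. Qed.

Lemma tensor_mul_linearl t : linear (tensor_mul^~ t).
Proof. exact: tensor_lift_linear. Qed.

Lemma tensor_mul_linearr s : linear (tensor_mul s).
Proof.
move=> c t1 t2; apply: tensor_lift_comb => a f.
exact: tensor_lift_linear.
Qed.

Fact tensor_mulA : associative tensor_mul.
Proof.
move=> s t u; move: s; apply: linear_tensor_ext.
- exact: tensor_mul_linearl.
- by move=> c s1 s2; rewrite !tensor_mul_linearl.
move=> a f; move: t; apply: linear_tensor_ext.
- by move=> c s1 s2; rewrite tensor_mul_linearl tensor_mul_linearr.
- by move=> c s1 s2; rewrite tensor_mul_linearr tensor_mul_linearl.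
move=> b h; move: u; apply: linear_tensor_ext.
- by move=> c s1 s2; rewrite !tensor_mul_linearr.
- exact: tensor_mul_linearr.
by move=> d k; rewrite !tensor_mulE !mulrA.
Qed.
Fact tensor_mul1r : left_id tensor_one tensor_mul.
Proof.
apply: linear_tensor_ext => // [|a f]; first exact: tensor_mul_linearr.
by rewrite tensor_mulE !mul1r.
Qed.
Fact tensor_mulr1 : right_id tensor_one tensor_mul.
Proof.
apply: linear_tensor_ext => // [|a f]; first exact: tensor_mul_linearl.
by rewrite tensor_mulE !mulr1.
Qed.
Fact tensor_mulrDl : left_distributive tensor_mul +%R.
Proof.
by move=> s1 s2 t; have := tensor_mul_linearl t 1 s1 s2; rewrite !scale1r.
Qed.
Fact tensor_mulrDr : right_distributive tensor_mul +%R.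
Proof.
by move=> s t1 t2; have := tensor_mul_linearr s 1 t1 t2; rewrite !scale1r.
Qed.
HB.instance Definition _ := GRing.Zmodule_isPzRing.Build tensor_fun
  tensor_mulA tensor_mul1r tensor_mulr1 tensor_mulrDl tensor_mulrDr.

End TensorFunAlgebra.

Section DiagonalAction.
Context (G : groupType) (K : comNzRingType) (A : algType K) (X : finType).
Context (toA : alg_action G A) (toX : set_action G X).
Local Notation B := {ffun X -> K^o}.
Local Notation T := (tensor_fun A X).

Definition fun_idem (x : X) : B := [ffun y => (y == x)%:R].

(* g maps \sum_x f(x) e_x to \sum_x f(x) e_(g x), with e_x the basis
   idempotents. *)
Definition fun_act (g : G) (f : B) : B := [ffun x => f (toX g^-1%g x)].

Lemma fun_act_idem g x : fun_act g (fun_idem x) = fun_idem (toX g x).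
Proof.
apply/ffunP => y; rewrite !ffunE; congr ((_ : bool)%:R).
apply/eqP/eqP => [<-|->]; rewrite -sactM ?(mulgV, mulVg) sact1 //.
Qed.

Lemma fun_act1 f : fun_act 1%g f = f.
Proof. by apply/ffunP => x; rewrite ffunE invg1 sact1. Qed.
Lemma fun_actM g h f : fun_act (g * h)%g f = fun_act g (fun_act h f).
Proof. by apply/ffunP => x; rewrite !ffunE invgM sactM. Qed.
Lemma fun_act_linear g : linear (fun_act g).
Proof. by move=> a f h; apply/ffunP => x; rewrite !ffunE. Qed.
Lemma fun_act_mul g f h : fun_act g (f * h) = fun_act g f * fun_act g h.
Proof. by apply/ffunP => x; rewrite !ffunE. Qed.
Lemma fun_act_one g : fun_act g 1 = 1.
Proof. by apply/ffunP => x; rewrite !ffunE. Qed.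

Definition diag_act_fun (g : G) : T -> T :=
  tensor_lift (fun (a : A) (f : B) => toA g a ⊗ fun_act g f).

Let bil g : bilinear_map (fun (a : A) (f : B) => toA g a ⊗ fun_act g f).
Proof.
split=> [a c f1 f2|f c a1 a2].
  by rewrite fun_act_linear (ptensor_bilinear _ _).1.
by rewrite linearP (ptensor_bilinear _ _).2.
Qed.

Lemma diag_act_linear g : linear (diag_act_fun g).
Proof. exact: tensor_lift_linear. Qed.

Lemma diag_act_ptensor g a f : diag_act_fun g (a ⊗ f) = toA g a ⊗ fun_act g f.
Proof. exact: tensor_liftE. Qed.

Fact diag_act_is_zmod_morphism g : zmod_morphism (diag_act_fun g).
Proof.
move=> s t; rewrite -scaleN1r addrC diag_act_linear scaleN1r addrC //.
Qed.
Fact diag_act_is_monoid_morphism g : monoid_morphism (diag_act_fun g).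
Proof.
split; first by rewrite [LHS]diag_act_ptensor rmorph1 fun_act_one.
move=> s t; move: s; apply: linear_tensor_ext.
- by move=> c s1 s2; rewrite [(_ + _) * _]tensor_mul_linearl diag_act_linear.
- by move=> c s1 s2; rewrite diag_act_linear [LHS]tensor_mul_linearl.
move=> a f; move: t; apply: linear_tensor_ext.
- by move=> c s1 s2; rewrite [_ * (_ + _)]tensor_mul_linearr diag_act_linear.
- by move=> c s1 s2; rewrite diag_act_linear [LHS]tensor_mul_linearr.
move=> b h; rewrite [X in diag_act_fun g X]tensor_mulE !diag_act_ptensor.
by rewrite [RHS]tensor_mulE rmorphM fun_act_mul.
Qed.
HB.instance Definition _ g := GRing.isZmodMorphism.Build T T (diag_act_fun g)
  (diag_act_is_zmod_morphism g).
HB.instance Definition _ g := GRing.isMonoidMorphism.Build T T (diag_act_fun g)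
  (diag_act_is_monoid_morphism g).

Fact diag_act1 t : diag_act_fun 1%g t = t.
Proof.
move: t; apply: linear_tensor_ext => // [|a f]; first exact: diag_act_linear.
by rewrite diag_act_ptensor aact1 fun_act1.
Qed.
Fact diag_actM g h t :
  diag_act_fun (g * h)%g t = diag_act_fun g (diag_act_fun h t).
Proof.
move: t; apply: linear_tensor_ext => [|c s t|a f]; first exact: diag_act_linear.
  by rewrite !diag_act_linear.
by rewrite !diag_act_ptensor aactM fun_actM.
Qed.

Definition diag_act : ring_action G T :=
  @RingAction G T (fun g => diag_act_fun g) diag_act1 diag_actM.

End DiagonalAction.

(* The skew group ring A ⋊ G: finitely supported functions G -> A, where
   << a *g g >> is the element written a g. *)

Definition skew_group_ring (G : groupType) (A : pzRingType)
  (to : ring_action G A) : Type := {malg A[G]}.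

Section SkewGroupRing.
Context (G : groupType) (A : pzRingType) (to : ring_action G A).
Local Notation S := (skew_group_ring to).
HB.instance Definition _ := GRing.Zmodule.on S.
Implicit Types u v w : S.

Definition skew_mul u v : S :=
  \sum_(g <- msupp u) \sum_(h <- msupp v)
    << u@_g * to g v@_h *g (g * h)%g >>.

Definition skew_one : S := << 1 *g 1%g >>.

Lemma skew_mulEw (d1 d2 : {fset G}) u v :
  (msupp u `<=` d1)%fset -> (msupp v `<=` d2)%fset ->
  skew_mul u v =
  \sum_(g <- d1) \sum_(h <- d2) << u@_g * to g v@_h *g (g * h)%g >>.
Proof.
move=> le_d1 le_d2; rewrite /skew_mul (big_fset_incl _ le_d1) /=.
  apply/eq_bigr=> g _; apply/big_fset_incl => // h _ /mcoeff_outdom ->.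
  by rewrite rmorph0 mulr0 monalgU0.
move=> g _ /mcoeff_outdom ug.
by rewrite big1 => // h _; rewrite ug mul0r monalgU0.
Qed.

Lemma skew_mulUU a b g h :
  skew_mul << a *g g >> << b *g h >> = << a * to g b *g (g * h)%g >>.
Proof. by rewrite (skew_mulEw msuppU_le msuppU_le) !big_seq_fset1 !mcoeffUU. Qed.

Fact skew_mulrDl : left_distributive skew_mul +%R.
Proof.
move=> u1 u2 v.
rewrite [in RHS](skew_mulEw (fsubsetUl _ (msupp u2)) (fsubset_refl _)).
rewrite [in RHS](skew_mulEw (fsubsetUr (msupp u1) _) (fsubset_refl _)).
rewrite (skew_mulEw (msuppD_le _ _) (fsubset_refl _)).
rewrite -big_split /=; apply/eq_bigr=> g _.
rewrite -big_split /=; apply/eq_bigr=> h _.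
by rewrite mcoeffD mulrDl monalgUD.
Qed.

Fact skew_mulrDr : right_distributive skew_mul +%R.
Proof.
move=> u v1 v2.
rewrite [in RHS](skew_mulEw (fsubset_refl _) (fsubsetUl _ (msupp v2))).
rewrite [in RHS](skew_mulEw (fsubset_refl _) (fsubsetUr (msupp v1) _)).
rewrite (skew_mulEw (fsubset_refl _) (msuppD_le _ _)).
rewrite -big_split /=; apply/eq_bigr=> g _.
rewrite -big_split /=; apply/eq_bigr=> h _.
by rewrite mcoeffD rmorphD mulrDr monalgUD.
Qed.

Let mul0 v : skew_mul 0 v = 0.
Proof. by apply: (addIr (skew_mul 0 v)); rewrite -skew_mulrDl !add0r. Qed.
Let mulr_0 u : skew_mul u 0 = 0.
Proof. by apply: (addIr (skew_mul u 0)); rewrite -skew_mulrDr !add0r. Qed.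

Lemma skew_ind (P : S -> Prop) :
  P 0 -> (forall u v, P u -> P v -> P (u + v)) ->
  (forall a g, P << a *g g >>) -> forall u, P u.
Proof.
move=> P0 PD PU u; rewrite [u]monalgE.
by elim/big_ind: _ => // g _; apply: PU.
Qed.

Fact skew_mulA : associative skew_mul.
Proof.
move=> u v w; elim/skew_ind: u => [|u1 u2 e1 e2|a g].
- by rewrite !mul0.
- by rewrite !skew_mulrDl e1 e2.
elim/skew_ind: v => [|v1 v2 e1 e2|b h].
- by rewrite mul0 !mulr_0 mul0.
- by rewrite skew_mulrDl !skew_mulrDr skew_mulrDl e1 e2.
elim/skew_ind: w => [|w1 w2 e1 e2|c k].
- by rewrite !mulr_0.
- by rewrite !skew_mulrDr e1 e2.
by rewrite !skew_mulUU rmorphM -ractM mulrA mulgA.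
Qed.
Fact skew_mul1r : left_id skew_one skew_mul.
Proof.
elim/skew_ind => [|u1 u2 e1 e2|a g]; rewrite ?mulr_0 ?skew_mulrDr ?e1 ?e2 //.
by rewrite skew_mulUU ract1 mul1r mul1g.
Qed.
Fact skew_mulr1 : right_id skew_one skew_mul.
Proof.
elim/skew_ind => [|u1 u2 e1 e2|a g]; rewrite ?mul0 ?skew_mulrDl ?e1 ?e2 //.
by rewrite skew_mulUU rmorph1 mulr1 mulg1.
Qed.
HB.instance Definition _ := GRing.Zmodule_isPzRing.Build S
  skew_mulA skew_mul1r skew_mulr1 skew_mulrDl skew_mulrDr.

End SkewGroupRing.

(* Main.v *)
Require Import Defs.
From HB Require Import structures.
From mathcomp Require Import all_boot all_order all_algebra.
From mathcomp Require Import finmap boolp reals complex monalg.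

Set Implicit Arguments.
Unset Strict Implicit.
Unset Printing Implicit Defensive.

Import GRing.Theory.
Local Open Scope ring_scope.

(** Write [T] for the tensor product of [R] with the functions on [X], [S] for
    its skew group ring and [e_x] for the idempotent of [T] at a point [x].
    The algebra [T] is the product of copies of [R] indexed by [X], its
    coordinates being given by [coord], so an element of [S] is an array of
    elements of [R] indexed by a group element and a point.

    Let [I] be a nonzero ideal of [S].  Multiplying a nonzero element of [I]
    by a group element and then by [e_x] on both sides yields, for some [x], a
    nonzero element of [I] in the corner [e_x S e_x].  Since [e_x h e_x]
    vanishes unless [h] fixes [x], this corner is the skew group ring of [R]
    with the stabiliser of [x], and the classical argument for outer actions on
    a simple ring applies to it.  Take a nonzero element of [I] in the corner
    with the fewest group elements in its support, and [k] in this support.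
    The values at [k] of the elements of [I] in the corner supported there form an
    ideal of [R], so some such [v] has coefficient [1] at [k]
    ([corner_coeff_normalize]).  For every [r] the commutator
    [r v - v (k^-1 r)] lies in [I] and has lost [k] from its support, so it
    vanishes by minimality.  Comparing coefficients at [h] gives
    [r v_h = v_h (h k^-1) r]; by simplicity of [R] a nonzero [v_h] is
    invertible, which makes [h k^-1] inner ([normalizing_inner]), hence
    [h = k].  Therefore [v = e_x k], and [e_x] lies in [I]
    ([corner_elt1_mem]).

    Conjugating by group elements and using transitivity, [I] contains every
    idempotent [e_y], hence their sum, which is [1]. *)

(** * Normalizing elements of a simple ring *)

Section SimpleRings.
Context (A : pzRingType).
Hypothesis simpleA : simple_ring A.

Lemma simple_ideal1 (I : A -> Prop) (c : A) :
  two_sided_ideal I -> I c -> c <> 0 -> I 1.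
Proof. by case/simpleA.2 => [I0 /I0|/(_ 1)]. Qed.

(** The relation makes [c A = A c] a two-sided ideal, so [c] has a right and a
    left inverse; surjectivity of [f] serves for the left one. *)
Lemma normalizing_inner (c : A) (f finv : A -> A) :
  cancel finv f -> c <> 0 ->
  (forall r, r * c = c * f r) -> inner_automorphism f.
Proof.
move=> finvK c0 cE.
have [d cd] : exists d, c * d = 1.
  apply: (@simple_ideal1 (fun z => exists d, c * d = z) c) => //; last first.
    by exists 1; rewrite mulr1.
  split=> [|_ _ [d <-] [d' <-]|a _ [d <-]]; first by exists 0; rewrite mulr0.
    by exists (d + d'); rewrite mulrDr.
  by split; [exists (f a * d); rewrite !mulrA cE | exists (d * a); rewrite mulrA].
have [b bc] : exists b, b * c = 1.
  by exists (finv d); rewrite cE finvK.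
have bd : b = d by rewrite -[b]mulr1 -cd mulrA bc mul1r.
exists b, c; split=> //; first by rewrite bd.
by move=> r; rewrite -mulrA cE mulrA bc mul1r.
Qed.

End SimpleRings.

(** * Ideals and corners *)

Section Ideals.
Context (S : pzRingType) (I : S -> Prop) (idealI : two_sided_ideal I).
Implicit Types u v : S.

Lemma idealD u v : I u -> I v -> I (u + v).
Proof. by case: idealI => _ ID _; apply: ID. Qed.

Lemma idealMl u v : I v -> I (u * v).
Proof. by case: idealI => _ _ IM Iv; case: (IM u v Iv). Qed.

Lemma idealMr u v : I u -> I (u * v).
Proof. by case: idealI => _ _ IM Iu; case: (IM v u Iu). Qed.

Lemma idealB u v : I u -> I v -> I (u - v).
Proof. by move=> Iu Iv; apply: idealD => //; rewrite -mulN1r; apply: idealMl. Qed.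

End Ideals.

Section PeirceCorner.
Context (S : pzRingType) (e : S).
Implicit Types u v : S.

Definition peirce u : Prop := e * u = u /\ u * e = u.

Lemma peirce0 : peirce 0.
Proof. by split; rewrite ?mul0r ?mulr0. Qed.

Lemma peirceD u v : peirce u -> peirce v -> peirce (u + v).
Proof. by case=> ul ur [vl vr]; split; rewrite ?mulrDl ?mulrDr ?ul ?ur ?vl ?vr. Qed.

Lemma peirceB u v : peirce u -> peirce v -> peirce (u - v).
Proof. by case=> ul ur [vl vr]; split; rewrite ?mulrBl ?mulrBr ?ul ?ur ?vl ?vr. Qed.

Lemma peirceM u v : peirce u -> peirce v -> peirce (u * v).
Proof.
by case=> ul ur [vl vr]; split; [rewrite mulrA ul | rewrite -mulrA vr].
Qed.

Lemma peirce_sandwich u : e * e = e -> peirce (e * u * e).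
Proof. by move=> ee; split; [rewrite !mulrA ee | rewrite -mulrA ee]. Qed.

End PeirceCorner.

(** * Coefficients in a skew group ring *)

Section SkewCoefficients.
Context (G : groupType) (A : pzRingType) (to : ring_action G A).
Local Notation S := (skew_group_ring to).
Implicit Types u : S.

Definition skew_mono (a : A) (g : G) : S := << a *g g >>.

Lemma coeff_mono a g h : (skew_mono a g)@_h = if g == h then a else 0.
Proof. by rewrite mcoeffU; case: eqP => _; rewrite ?mulr1n ?mulr0n. Qed.

Lemma mono1 : 1 = skew_mono 1 1%g.
Proof. by []. Qed.

Lemma mono_sum (J : finType) (F : J -> A) g :
  skew_mono (\sum_j F j) g = \sum_j skew_mono (F j) g.
Proof.
apply: (big_morph (skew_mono^~ g)) => [a b|]; first exact: monalgUD.
exact: monalgU0.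
Qed.

Lemma mono_mul a b g h :
  skew_mono a g * skew_mono b h = skew_mono (a * to g b) (g * h)%g.
Proof. exact: skew_mulUU. Qed.

Lemma coeffD u v h : (u + v : S)@_h = u@_h + v@_h.
Proof. exact: mcoeffD. Qed.
Lemma coeffB u v h : (u - v : S)@_h = u@_h - v@_h.
Proof. exact: mcoeffB. Qed.
Lemma coeff0 h : (0 : S)@_h = 0.
Proof. exact: mcoeff0. Qed.

Lemma coeff_monol a u h : (skew_mono a 1%g * u)@_h = a * u@_h.
Proof.
elim/skew_ind: u => [|u v eu ev|b g]; first by rewrite mulr0 !coeff0 mulr0.
  by rewrite mulrDr !coeffD eu ev mulrDr.
rewrite -/(skew_mono b g) mono_mul !coeff_mono mul1g ract1.
by case: eqP => _; rewrite ?mulr0.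
Qed.

(** Right multiplication by [k] permutes the coefficients, so the formula is
    stated at [h * k], where no division appears. *)
Lemma coeff_monor u b k h :
  (u * skew_mono b k)@_(h * k)%g = u@_h * to h b.
Proof.
elim/skew_ind: u => [|u v eu ev|a g]; first by rewrite mul0r !coeff0 mul0r.
  by rewrite mulrDl !coeffD eu ev mulrDl.
rewrite -/(skew_mono a g) mono_mul !coeff_mono (inj_eq (mulIg k)).
by case: eqP => [->|]; rewrite ?mul0r.
Qed.

End SkewCoefficients.

(** * The tensor product as a power of the algebra *)

Lemma linear_funZ (K : pzRingType) (V U : lmodType K) (f : V -> U) a v :
  linear f -> f (a *: v) = a *: f v.
Proof. by move=> lf; rewrite -[a *: v]addr0 lf (linear_fun0 lf) addr0. Qed.

Section Coordinates.
Context (K : comNzRingType) (A : algType K) (X : finType).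
Local Notation B := {ffun X -> K^o}.
Local Notation T := (tensor_fun A X).
Implicit Types (s t : T) (x y : X) (a : A).

(** Functions on [X] form a power of [K], so [T] is a power of [A]; this is the
    projection to the factor at [x]. *)
Definition coord x (t : T) : A :=
  tensor_lift (fun (a : A) (f : B) => (f x : K) *: a) t.

Let bil x : bilinear_map (fun (a : A) (f : B) => (f x : K) *: a).
Proof.
split=> [a c f1 f2|f c a1 a2]; first by rewrite !ffunE scalerDl scalerA.
by rewrite scalerDr !scalerA mulrC.
Qed.

Fact coord_linear x : linear (coord x).
Proof. exact: tensor_lift_linear. Qed.
HB.instance Definition _ x :=
  GRing.isLinear.Build K T A *:%R (coord x) (coord_linear x).

Lemma coord_ptensor x a (f : B) : coord x (a ⊗ f) = (f x : K) *: a.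
Proof. exact: tensor_liftE. Qed.

Lemma coordM x s t : coord x (s * t) = coord x s * coord x t.
Proof.
move: s; apply: linear_tensor_ext => [c s1 s2|c s1 s2|a f].
- by rewrite [_ * t]tensor_mul_linearl linearP.
- by rewrite linearP mulrDl scalerAl.
move: t; apply: linear_tensor_ext => [c s1 s2|c s1 s2|b h].
- by rewrite [_ * (_ + _)]tensor_mul_linearr linearP.
- by rewrite linearP mulrDr scalerAr.
rewrite [X in coord x X]tensor_mulE !coord_ptensor ffunE.
by rewrite -scalerAl -scalerAr scalerA.
Qed.

Lemma coord1 x : coord x 1 = 1.
Proof. by rewrite [LHS]coord_ptensor ffunE scale1r. Qed.

Definition at_point x a : T := a ⊗ fun_idem K x.

Lemma at_pointE x y a : coord y (at_point x a) = if y == x then a else 0.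
Proof.
by rewrite coord_ptensor ffunE; case: eqP => _; rewrite ?scale1r ?scale0r.
Qed.

(** The coordinates determine a tensor: it suffices to check this on
    [a ⊗ f], where it is the expansion of [f] on the basis idempotents. *)
Lemma coord_sum t : t = \sum_x at_point x (coord x t).
Proof.
move: t; apply: linear_tensor_ext => // [c s t|a f].
  rewrite scaler_sumr -big_split /=; apply: eq_bigr => x _.
  by rewrite linearP [at_point _ _](ptensor_bilinear _ _).2.
have fE : f = \sum_x (f x : K) *: fun_idem K x.
  apply/ffunP => y; rewrite sum_ffunE (bigD1 y) //= !ffunE eqxx big1.
    by rewrite addr0 [_ *: _]mulr1.
  by move=> x /negPf xy; rewrite !ffunE eq_sym xy scaler0.
have [lin_r lin_l] := ptensor_bilinear A B.
rewrite {1}fE (@big_morph _ _ (fun f : B => a ⊗ f) 0 +%R); last first.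
- exact: linear_fun0.
- by move=> f1 f2; rewrite -[f1]scale1r lin_r !scale1r.
apply: eq_bigr => x _; rewrite coord_ptensor /at_point.
by rewrite (linear_funZ _ _ (lin_r a)) (linear_funZ _ _ (lin_l _)).
Qed.

Lemma coord_ext s t : (forall x, coord x s = coord x t) -> s = t.
Proof.
by move=> st; rewrite (coord_sum s) (coord_sum t); under eq_bigr do rewrite st.
Qed.

Lemma at_pointM x a b : at_point x a * at_point x b = at_point x (a * b).
Proof.
apply: coord_ext => y; rewrite coordM !at_pointE.
by case: eqP; rewrite ?mulr0.
Qed.

Lemma at_point1_sum : 1 = \sum_x at_point x 1 :> T.
Proof. by rewrite [LHS]coord_sum; under eq_bigr do rewrite coord1. Qed.

End Coordinates.

(** * The corner of the skew group ring at a point *)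

Section Corner.
Context (K : comNzRingType) (R : algType K) (G : groupType) (X : finType).
Context (toR : alg_action G R) (toX : set_action G X).
Local Notation S := (skew_group_ring (diag_act toR toX)).
Implicit Types (u v w : S) (x y : X) (g h k : G) (r s : R).

Lemma diag_act_at_point g x r :
  diag_act toR toX g (at_point x r) = at_point (toX g x) (toR g r).
Proof. by rewrite [LHS]diag_act_ptensor fun_act_idem. Qed.

Definition corner_elt x r : S := skew_mono _ (at_point x r) 1%g.
Definition corner_coeff x u h : R := coord x u@_h.
Local Notation in_corner x := (peirce (corner_elt x 1)).

Lemma corner_eltM x r s : corner_elt x r * corner_elt x s = corner_elt x (r * s).
Proof. by rewrite mono_mul mulg1 ract1 at_pointM. Qed.

Lemma coeff_corner_eltl x r u h : (corner_elt x r * u)@_h = at_point x r * u@_h.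
Proof. exact: coeff_monol. Qed.

Lemma coeff_corner_eltr x r u h :
  (u * corner_elt x r)@_h = u@_h * at_point (toX h x) (toR h r).
Proof. by rewrite -[h in LHS]mulg1 coeff_monor diag_act_at_point. Qed.

Lemma coeff_corner_eltl0 x r u h :
  u@_h = 0 -> (corner_elt x r * u)@_h = 0.
Proof. by rewrite coeff_corner_eltl => ->; rewrite mulr0. Qed.

Lemma coeff_corner_eltr0 x r u h :
  u@_h = 0 -> (u * corner_elt x r)@_h = 0.
Proof. by rewrite coeff_corner_eltr => ->; rewrite mul0r. Qed.

Lemma corner_elt1M x r : corner_elt x 1 * corner_elt x r = corner_elt x r.
Proof. by rewrite corner_eltM mul1r. Qed.

Lemma corner_eltM1 x r : corner_elt x r * corner_elt x 1 = corner_elt x r.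
Proof. by rewrite corner_eltM mulr1. Qed.

Lemma corner_elt_peirce x r : in_corner x (corner_elt x r).
Proof. by split; [exact: corner_elt1M | exact: corner_eltM1]. Qed.

Lemma cornerMl x r u : in_corner x u -> in_corner x (corner_elt x r * u).
Proof. exact/peirceM/corner_elt_peirce. Qed.

Lemma cornerMr x r u : in_corner x u -> in_corner x (u * corner_elt x r).
Proof. by move=> uE; apply: peirceM => //; exact: corner_elt_peirce. Qed.

Lemma corner_coeffMl x r u h :
  corner_coeff x (corner_elt x r * u) h = r * corner_coeff x u h.
Proof. by rewrite /corner_coeff coeff_corner_eltl coordM at_pointE eqxx. Qed.

(** The right factor [e_x] moves past [h] as the idempotent at [h x], which is
    orthogonal to [e_x] unless [h] fixes [x]. *)
Lemma corner_coeff_stab x u h :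
  in_corner x u -> corner_coeff x u h <> 0 -> toX h x = x.
Proof.
case=> _ <-; rewrite /corner_coeff coeff_corner_eltr coordM at_pointE.
by case: eqP => // _; rewrite mulr0.
Qed.

Lemma corner_coeffMr x r u h : in_corner x u ->
  corner_coeff x (u * corner_elt x r) h = corner_coeff x u h * toR h r.
Proof.
move=> uE; rewrite /corner_coeff coeff_corner_eltr coordM at_pointE.
have [->|/eqP/(corner_coeff_stab uE) ->] := eqVneq (coord x u@_h) 0.
  by rewrite !mul0r.
by rewrite eqxx.
Qed.

(** Left and right multiplication by [R] act on each coefficient separately; the
    descent on supports rests on this. *)
Lemma coeff_commutator0 x r s v h : v@_h = 0 ->
  (corner_elt x r * v - v * corner_elt x s)@_h = 0.
Proof.
move=> vh; apply: etrans (coeffB _ _ _) _; apply/eqP; rewrite subr_eq0; apply/eqP.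
exact: etrans (coeff_corner_eltl0 _ _ vh) (esym (coeff_corner_eltr0 _ _ vh)).
Qed.

Lemma corner_coeff_commutator x r s v h : in_corner x v ->
  corner_coeff x (corner_elt x r * v - v * corner_elt x s) h
    = r * corner_coeff x v h - corner_coeff x v h * toR h s.
Proof.
move=> vE; rewrite -corner_coeffMl -corner_coeffMr //.
by rewrite -raddfB -coeffB.
Qed.

(** The coefficients of a corner element lie in [e_x T], so their other
    coordinates vanish. *)
Lemma corner_coeff_eq x u v h : in_corner x u -> in_corner x v ->
  corner_coeff x u h = corner_coeff x v h -> u@_h = v@_h.
Proof.
move=> uE vE uv; apply: coord_ext => y; have [->//|yx] := eqVneq y x.
suff off w : in_corner x w -> coord y w@_h = 0 by rewrite !off.
case=> <- _; rewrite coeff_corner_eltl coordM at_pointE (negPf yx).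
by rewrite mul0r.
Qed.

Lemma corner_ext x u v : in_corner x u -> in_corner x v ->
  corner_coeff x u =1 corner_coeff x v -> u = v.
Proof. by move=> uE vE uv; apply/malgP => h; apply: (corner_coeff_eq uE vE). Qed.

Lemma corner_neq0 x u : in_corner x u -> u <> 0 ->
  exists h, corner_coeff x u h <> 0.
Proof.
move=> uE u0; apply: contrapT => all0; apply: u0; apply: (corner_ext uE).
  exact: peirce0.
move=> h; rewrite /corner_coeff coeff0 raddf0.
by apply: contrapT => uh; apply: all0; exists h.
Qed.

Lemma corner_stab_mono x k : toX k x = x ->
  in_corner x (skew_mono _ (at_point x 1) k).
Proof.
move=> kx; split; rewrite mono_mul.
  by rewrite ract1 at_pointM mulr1 mul1g.
by rewrite diag_act_at_point kx rmorph1 at_pointM mulr1 mulg1.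
Qed.

(** * Ideals of the skew group ring *)

Section Ideal.
Hypotheses (simpleR : simple_ring R) (outerR : outer_action toR).
Context (I : S -> Prop) (idealI : two_sided_ideal I).

Let ID := idealD idealI.
Let IB := idealB idealI.
Let IMl := idealMl idealI.
Let IMr := idealMr idealI.

(** The coefficients at [k] of the elements of [I] in the corner with support
    in that of [u] form a two-sided ideal of [R]; it contains [u_k], hence
    [1]. *)
Lemma corner_coeff_normalize x u k : I u -> in_corner x u ->
  corner_coeff x u k <> 0 ->
  exists v, [/\ I v, in_corner x v, corner_coeff x v k = 1
            & forall h, u@_h = 0 -> v@_h = 0].
Proof.
move=> Iu uE uk.
pose J r := exists v, [/\ I v, in_corner x v, corner_coeff x v k = r
            & forall h, u@_h = 0 -> v@_h = 0].
apply: (simple_ideal1 (I := J) simpleR _ _ uk); last by exists u.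
split=> [|_ _ [v [Iv vE <- vu]] [w [Iw wE <- wu]]|r _ [v [Iv vE <- vu]]].
- exists 0; split; [by case: idealI | exact: peirce0 | |].
    by rewrite /corner_coeff coeff0 raddf0.
  by move=> h _; rewrite coeff0.
- exists (v + w); split; [exact: ID | exact: peirceD | |].
    by rewrite /corner_coeff coeffD raddfD.
  by move=> h uh; rewrite coeffD vu // wu // addr0.
split.
  exists (corner_elt x r * v); split; [exact: IMl|exact: cornerMl| |].
    exact: corner_coeffMl.
  by move=> h uh; apply/coeff_corner_eltl0/vu.
(* Moving a scalar across [k] twists it by [k], hence [k^-1 r]. *)
exists (v * corner_elt x (toR k^-1%g r)).
split; [exact: IMr|exact: cornerMr| |].
  by rewrite corner_coeffMr // -aactM mulgV aact1.
by move=> h uh; apply/coeff_corner_eltr0/vu.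
Qed.

(** A second coefficient [v_h] would be normalizing, with [h * k^-1] as its
    twist; this automorphism would then be inner, against outerness. *)
Lemma corner_twisted_central x v k : in_corner x v -> corner_coeff x v k = 1 ->
  (forall r, corner_elt x r * v = v * corner_elt x (toR k^-1%g r)) ->
  v = skew_mono _ (at_point x 1) k.
Proof.
move=> vE vk comm.
have kx : toX k x = x.
  by apply: (corner_coeff_stab vE); rewrite vk; exact: simpleR.1.
apply: (corner_ext vE (corner_stab_mono kx)) => h.
rewrite {2}/corner_coeff coeff_mono; case: eqP => [<-|kh].
  by rewrite at_pointE eqxx.
rewrite raddf0; apply: contrapT => vh.
have hk1 : (h * k^-1)%g <> 1%g by move/divg1_eq; apply/nesym.
apply: (outerR hk1).
apply: (@normalizing_inner R simpleR _ _ (toR (h * k^-1)^-1%g) _ vh) => r.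
  by rewrite -aactM mulgV aact1.
by rewrite -corner_coeffMl comm corner_coeffMr // -aactM.
Qed.

(** Induction on the size of the support plays the part of a choice of [u] with
    minimal support.  Keeping [k] arbitrary, rather than translating the
    support so that [k] becomes the identity, keeps every support inside that
    of [u]. *)
Lemma corner_elt1_mem x u : I u -> in_corner x u -> u <> 0 ->
  I (corner_elt x 1).
Proof.
have [n] := ubnP #|` msupp u|; elim: n u => // n IHn u u_n Iu uE.
move=> /(corner_neq0 uE) [k uk].
have [v [Iv vE vk vu]] := corner_coeff_normalize Iu uE uk.
(* A nonzero commutator vanishes at [k], so its support is strictly smaller. *)
have [[r [w [wE wN0]]]|comm] := pselect (exists r w,
    w = corner_elt x r * v - v * corner_elt x (toR k^-1%g r) /\ w <> 0).
  have w_in : in_corner x w.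
    by rewrite wE; apply: peirceB; [exact: cornerMl | exact: cornerMr].
  apply: (IHn w) => //; last first.
    by rewrite wE; apply: IB; [exact: IMl | exact: IMr].
  rewrite -ltnS (leq_trans _ u_n) // ltnS; apply: fproper_ltn_card.
  rewrite fproperE; apply/andP; split.
    apply/fsubsetP => h; rewrite -!mcoeff_neq0; apply: contraNN => /eqP/vu vh.
    by apply/eqP; rewrite wE; apply: coeff_commutator0.
  have ku : k \in msupp u.
    rewrite -mcoeff_neq0; apply/eqP => uk0.
    by apply: uk; rewrite /corner_coeff uk0 raddf0.
  apply/fsubsetP => /(_ k ku); rewrite -mcoeff_neq0 => /eqP; apply.
  rewrite -(@coeff0 G _ (diag_act toR toX) k).
  apply: (corner_coeff_eq w_in); first exact: peirce0.
  rewrite wE corner_coeff_commutator // vk -aactM mulgV aact1 mulr1 mul1r subrr.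
  by rewrite /corner_coeff coeff0 raddf0.
have vk1 : v = skew_mono _ (at_point x 1) k.
  apply: (corner_twisted_central vE vk) => r.
  apply: contrapT => rv; apply: comm; exists r; eexists; split; first by [].
  by move/subr0_eq.
suff -> : corner_elt x 1 = v * skew_mono _ 1 k^-1%g by apply: IMr.
by rewrite vk1 mono_mul mulgV rmorph1 mulr1.
Qed.

Lemma exists_corner_elt1_mem u : I u -> u <> 0 -> exists x, I (corner_elt x 1).
Proof.
move=> Iu uN0.
have [g [x ugx]] : exists g x, corner_coeff x u g <> 0.
  apply: contrapT => all0; apply: uN0; apply/malgP => g; rewrite mcoeff0.
  apply: coord_ext => x; rewrite raddf0; apply: contrapT => ugx.
  by apply: all0; exists g, x.
(* Moving [g] to the identity puts the coefficient on a group element that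
   fixes [x], so that it survives in the corner. *)
exists x; pose v := u * skew_mono _ 1 g^-1%g.
apply: (@corner_elt1_mem x (corner_elt x 1 * v * corner_elt x 1)).
- exact/IMr/IMl/IMr.
- exact/peirce_sandwich/corner_elt1M.
move=> /(congr1 (fun w : S => corner_coeff x w 1%g)).
rewrite /corner_coeff coeff_corner_eltr coordM coeff_corner_eltl coordM.
rewrite coeff0 raddf0 sact1 rmorph1 at_pointE eqxx mul1r mulr1.
by rewrite -(mulgV g) coeff_monor rmorph1 mulr1.
Qed.

Lemma corner_elt1_conj x g : I (corner_elt x 1) -> I (corner_elt (toX g x) 1).
Proof.
move=> Ix.
have -> : corner_elt (toX g x) 1
    = skew_mono _ 1 g * corner_elt x 1 * skew_mono _ 1 g^-1%g.
  by rewrite !mono_mul mul1r diag_act_at_point !rmorph1 mulr1 mulg1 mulgV.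
exact/IMr/IMl.
Qed.

Lemma corner_elt1_all_mem1 : (forall x, I (corner_elt x 1)) -> I 1.
Proof.
move=> Iall.
rewrite mono1 at_point1_sum mono_sum.
by apply: (big_ind I) => [|u v|x _]; [case: idealI | exact: ID | exact: Iall].
Qed.

End Ideal.

Theorem simple_skew_group_ring :
  simple_ring R -> outer_action toR -> transitive_action toX ->
  simple_ring S.
Proof.
move=> simpleR outerR [x0 trans]; split=> [|I idealI].
  move=> /(congr1 (fun w : S => corner_coeff x0 w 1%g)).
  rewrite /corner_coeff coeff0 raddf0 mono1.
  by rewrite coeff_mono eqxx coord1; exact: simpleR.1.
have [I0 _ IM] := idealI.
have [[u [Iu uN0]]|all0] := pselect (exists u, I u /\ u <> 0); last first.
  left=> u; split=> [Iu|->//]; apply: contrapT => uN0.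
  by apply: all0; exists u.
right=> v; rewrite -[v]mulr1; apply: (IM v 1 _).1.
apply: (corner_elt1_all_mem1 idealI) => y.
have [x Ix] := exists_corner_elt1_mem simpleR outerR idealI Iu uN0.
have [[g gx] [h hy]] := (trans x, trans y).
have -> : y = toX (h * g^-1)%g x.
  by rewrite -gx -sactM -mulgA mulVg mulg1.
exact: corner_elt1_conj.
Qed.

End Corner.

Theorem proposition0p3 (RR : realType) (R : algType RR[i]) (G : groupType)
    (X : finType) (toR : alg_action G R) (toX : set_action G X) :
  simple_ring R ->
  outer_action toR ->
  transitive_action toX ->
  simple_ring (skew_group_ring (diag_act toR toX)).
Proof. exact: simple_skew_group_ring. Qed.
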